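(* Let $Q_n$ be the para-chain square cactus of length $n$, and let $Q_n'$ be the graph obtained from $Q_n$ by attaching two pendant vertices to its end vertex $c_n$. For every $n\ge 3$, $$D(Q_n,x)=(x^3+2x^2+x)D(Q_{n-1},x)+(x^3+2x^2)D(Q_{n-2},x)+(x^3+3x^2)D(Q_{n-2}',x)+(2x^4+4x^3)D(Q_{n-3}',x),$$ with initial conditions $D(Q_1,x)=x^4+4x^3+6x^2$ and $D(Q_2,x)=x^7+7x^6+21x^5+29x^4+15x^3$.
   Context: For a finite simple graph $G=(V,E)$, a set $S\subseteq V$ is dominating if every vertex of $V\setminus S$ is adjacent to at least one vertex of $S$. Let $d(G,i)$ be the number of dominating sets of $G$ of cardinality $i$. The domination polynomial of $G$ is $D(G,x)=\sum_{i=\gamma(G)}^{|V|} d(G,i)x^i$, where $\gamma(G)$ is the minimum cardinality of a dominating set. The para-chain $Q_n$ is the chain of $n$ squares ($4$-cycles), consecutive squares sharing a cut-vertex, in which the two cut-vertices of each internal square are non-adjacent. Concretely, $Q_n$ has vertices $c_0,\dots,c_n,a_1,\dots,a_n,b_1,\dots,b_n$ and edges $c_{i-1}a_i,\ a_ic_i,\ c_ib_i,\ b_ic_{i-1}$ for $1\le i\le n$; $Q_0$ is the single vertex $c_0$. The graph $Q_n'$ ($n\ge 0$) is obtained from $Q_n$ by adding two new vertices, each joined only to $c_n$; in particular $Q_0'$ is the path on three vertices. *)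

(* Defs.v *)
From HB Require Import structures.
From mathcomp Require Import all_boot all_order all_algebra.

Set Implicit Arguments.
Unset Strict Implicit.
Unset Printing Implicit Defensive.

Import GRing.Theory.
Local Open Scope ring_scope.

Record sgraph := SGraph {
  vertex :> finType;
  adj : rel vertex;
  adj_sym : symmetric adj;
  adj_irrefl : irreflexive adj
}.

Section Domination.
Variable G : sgraph.

Definition dominating (S : {set G}) : bool :=
  [forall v : G, (v \notin S) ==> [exists u : G, (u \in S) && adj v u]].

Definition domination_number : nat :=
  #|[arg min_(S < [set: G] | dominating S) #|S|]|.

Definition num_dominating (i : nat) : nat :=
  #|[set S : {set G} | dominating S & #|S| == i]|.

Definition domination_poly : {poly int} :=
  \sum_(domination_number <= i < #|G|.+1) (num_dominating i)%:R *: 'X^i.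

(* [arg min] only returns a minimiser when its seed satisfies the predicate. *)
Lemma dominating_setT : dominating [set: G].
Proof. by apply/forallP => v; rewrite inE. Qed.

End Domination.

(* The vertices of the para-chain with n squares: inl i is c_i (0 <= i <= n),
   inr (inl j) is a_{j+1} and inr (inr j) is b_{j+1} (0 <= j < n). *)
Definition para_vertex (n : nat) : finType := ('I_n.+1 + ('I_n + 'I_n))%type.

(* c_i is an end of the (j+1)-st square, whose ends are c_j and c_{j+1}. *)
Definition square_end (n : nat) (i : 'I_n.+1) (j : 'I_n) : bool :=
  (i == j :> nat) || (i == j.+1 :> nat).

Definition para_adj (n : nat) : rel (para_vertex n) := fun u v =>
  match u, v with
  | inl i, inr (inl j) | inr (inl j), inl i => square_end i j
  | inl i, inr (inr j) | inr (inr j), inl i => square_end i j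
  | _, _ => false
  end.

Lemma para_adj_sym (n : nat) : symmetric (@para_adj n).
Proof. by move=> [i|[j|j]] [i'|[j'|j']]. Qed.

Lemma para_adj_irrefl (n : nat) : irreflexive (@para_adj n).
Proof. by move=> [i|[j|j]]. Qed.

Definition para_chain (n : nat) : sgraph :=
  SGraph (@para_adj_sym n) (@para_adj_irrefl n).

Section TwoPendants.
Variables (G : sgraph) (c : G).

Definition two_pendants_vertex : finType := (G + 'I_2)%type.

Definition two_pendants_adj : rel two_pendants_vertex := fun u v =>
  match u, v with
  | inl x, inl y => adj x y
  | inl x, inr _ | inr _, inl x => x == c
  | inr _, inr _ => false
  end.

Lemma two_pendants_adj_sym : symmetric two_pendants_adj.
Proof. by move=> [x|p] [y|q] //=; apply: adj_sym. Qed.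

Lemma two_pendants_adj_irrefl : irreflexive two_pendants_adj.
Proof. by move=> [x|p] //=; apply: adj_irrefl. Qed.

Definition two_pendants : sgraph :=
  SGraph two_pendants_adj_sym two_pendants_adj_irrefl.

End TwoPendants.

Definition para_chain' (n : nat) : sgraph :=
  @two_pendants (para_chain n) (inl ord_max).

(* Main.v *)
Require Import Defs.
From mathcomp Require Import all_boot all_order all_algebra.
From mathcomp Require Import ring zify.

Set Implicit Arguments.
Unset Strict Implicit.
Unset Printing Implicit Defensive.

Import GRing.Theory.
Local Open Scope ring_scope.

(** Root a graph at a vertex and classify the sets that dominate every vertex
    except possibly the root by the state of the root: in the set (A),
    outside but dominated (B), or undominated (U).  Gluing a square at the root
    of [Q_n] and moving the root to the opposite corner acts linearly on the
    three generating polynomials: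
      A' = x (1 + x)^2 (A + B) + (x^3 + 2 x^2) U,
      B' = (2 x + x^2) A + x^2 (B + U),
      U' = A.
    Moreover [D(Q_n) = A + B] and [D(Q_n') = (1 + x)^2 A + x^2 (B + U)], so the
    recurrence is a polynomial identity in the values of A, B, U at [n - 3]. *)

(** * Domination with an exempt root, and the three root states *)

Section RootedPolynomial.
Variable G : sgraph.
Implicit Types (S : {set G}) (r v : G) (g : bool -> bool -> {poly int}).

Definition dominated S v : bool :=
  (v \in S) || [exists u, (u \in S) && adj v u].

Definition dominating_off r S : bool :=
  [forall v, (v != r) ==> dominated S v].

(* [g] weights the state of the root: whether it is dominated, and whether it
   belongs to the set. *)
Definition rooted_poly r g : {poly int} :=
  \sum_(S : {set G} | dominating_off r S)
    g (dominated S r) (r \in S) * 'X^#|S|.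

Lemma dominatingE S : dominating S = [forall v, dominated S v].
Proof. by apply: eq_forallb => v; rewrite /dominated; case: (v \in S). Qed.

(** Used for gluing at [r]: the old vertices keep their neighbourhoods except [r], and [e] records
    whether some new neighbour of [r] was chosen. *)
Lemma forall_dominated_root r S (e : bool) :
  [forall x, dominated S x || (x == r) && e]
    = dominating_off r S && (dominated S r || e).
Proof.
apply/forallP/andP => [domS | [/forallP domS rS] x].
  split; last by have := domS r; rewrite eqxx.
  by apply/forallP => x; have := domS x; case: eqP => //=; rewrite orbF.
by have := domS x; have [-> | _ /= ->] := eqVneq x r; rewrite ?eqxx.
Qed.

Lemma dominating_rootE r S :
  dominating S = dominating_off r S && dominated S r.
Proof.
rewrite dominatingE -[dominated S r]orbF -forall_dominated_root.
by apply: eq_forallb => x; rewrite andbF orbF.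
Qed.

Lemma domination_polyE :
  domination_poly G = \sum_(S : {set G} | dominating S) 'X^#|S|.
Proof.
rewrite /domination_poly /domination_number.
case: arg_minnP => [|S0 domS0 minS0]; first exact: dominating_setT.
under eq_bigr => i _.
  rewrite (_ : _ *: _ =
      \sum_(S : {set G} | dominating S && (#|S| == i)) 'X^#|S|); first over.
  rewrite (eq_bigr (fun=> 'X^i)); last by move=> S /andP[_ /eqP ->].
  by rewrite sumr_const scaler_nat /num_dominating cardsE.
rewrite (exchange_big_dep (@dominating G)) /=; last by move=> i S _ /andP[].
apply: eq_bigr => S domS; rewrite domS /=.
(* Each dominating [S] contributes to the single index [#|S|], which lies in the summation range by
   minimality of [S0]. *)
rewrite (big_rem #|S|) /= ?eqxx; last first.
  by rewrite mem_index_iota minS0 // ltnS max_card.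
rewrite big1_seq ?addr0 // => i /andP[/eqP <-].
by rewrite mem_rem_uniq ?iota_uniq // !inE eqxx.
Qed.

Lemma domination_poly_rooted r :
  domination_poly G = rooted_poly r (fun d _ => d%:R).
Proof.
rewrite domination_polyE /rooted_poly big_mkcond [RHS]big_mkcond.
apply: eq_bigr => S _; rewrite (dominating_rootE r).
by case: dominating_off; case: dominated; rewrite ?mul1r ?mul0r.
Qed.

(** A member of the set counts as dominated, so the value [g false true] never occurs and three
    states remain. *)
Lemma rooted_polyE r g :
  rooted_poly r g =
    g true true * rooted_poly r (fun _ i => i%:R)
    + g true false * rooted_poly r (fun d i => (d && ~~ i)%:R)
    + g false false * rooted_poly r (fun d i => (~~ d)%:R).
Proof.
rewrite /rooted_poly !big_distrr -!big_split /=.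
apply: eq_bigr => S _; rewrite /dominated.
by case: (r \in S); case: [exists _, _] => /=; ring.
Qed.

End RootedPolynomial.

Lemma rooted_poly_iso (G H : sgraph) (f : G -> H) (r : G) g :
    bijective f -> {mono f : x y / adj x y >-> adj x y} ->
  rooted_poly (f r) g = rooted_poly r g.
Proof.
move=> bij_f adj_f; have inj_f := bij_inj bij_f; have [f' fK f'K] := bij_f.
have dom_f (S : {set G}) x : dominated (f @: S) (f x) = dominated S x.
  rewrite /dominated mem_imset //; congr (_ || _).
  apply/existsP/existsP => -[u /andP[uS adj_u]].
    exists (f' u); rewrite -(mem_imset _ _ inj_f) f'K uS.
    by rewrite -adj_f f'K.
  by exists (f u); rewrite mem_imset // uS adj_f.
rewrite /rooted_poly (reindex (fun S : {set G} => f @: S)) /=.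
  apply: eq_big => S; last by move=> _; rewrite dom_f mem_imset // card_imset.
  apply/forallP/forallP => domS x.
    by have := domS (f x); rewrite (inj_eq inj_f) dom_f.
  by rewrite -(f'K x) (inj_eq inj_f) dom_f.
apply: onW_bij; exists (fun S : {set H} => f' @: S) => S.
  by rewrite -imset_comp (eq_imset _ fK) imset_id.
by rewrite -imset_comp (eq_imset _ f'K) imset_id.
Qed.

(** * Subsets of disjoint unions and of types with one or two elements *)

Section SetSum.
Variables (T1 T2 : finType).

Definition set_sum (A : {set T1}) (B : {set T2}) : {set T1 + T2} :=
  [set v | match v with inl x => x \in A | inr y => y \in B end].

Lemma inl_set_sum A B x : (inl x \in set_sum A B) = (x \in A).
Proof. by rewrite inE. Qed.

Lemma inr_set_sum A B y : (inr y \in set_sum A B) = (y \in B).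
Proof. by rewrite inE. Qed.

Lemma card_set_sum A B : #|set_sum A B| = (#|A| + #|B|)%N.
Proof.
rewrite -!sum1_card !big_mkcond big_sumType /= [in RHS]big_mkcond /=.
by congr (_ + _)%N; [|rewrite [RHS]big_mkcond];
  apply: eq_bigr => x _; rewrite inE.
Qed.

Lemma big_set_sum (F : {set T1 + T2} -> {poly int}) :
  \sum_S F S = \sum_A \sum_B F (set_sum A B).
Proof.
rewrite pair_bigA (reindex (fun p => set_sum p.1 p.2)) //=.
apply: onW_bij.
exists (fun S : {set T1 + T2} =>
          ([set x | inl x \in S], [set y | inr y \in S])).
  by move=> [A B] /=; congr (_, _); apply/setP => x; rewrite !inE.
by move=> S; apply/setP => -[x|y]; rewrite !inE.
Qed.

Lemma exists_sum (P : pred (T1 + T2)) :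
  [exists v, P v] = [exists x, P (inl x)] || [exists y, P (inr y)].
Proof.
apply/existsP/orP => [[[x|y] Pv] | [/existsP[x Px] | /existsP[y Py]]].
- by left; apply/existsP; exists x.
- by right; apply/existsP; exists y.
- by exists (inl x).
- by exists (inr y).
Qed.

Lemma forall_sum (P : pred (T1 + T2)) :
  [forall v, P v] = [forall x, P (inl x)] && [forall y, P (inr y)].
Proof.
apply/forallP/andP => [all_P | [/forallP Pl /forallP Pr] [x|y] //].
by split; apply/forallP.
Qed.

End SetSum.

Lemma existsb_false (T : finType) (P : pred T) :
  [exists x, P x && false] = false.
Proof. by apply/existsP => -[x]; rewrite andbF. Qed.

Section SmallSets.
Variable T : finType.

Lemma big_set_single (x : T) (F : {set T} -> {poly int}) :
  (forall z, z = x) -> \sum_S F S = \sum_(b : bool) F [set z | b].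
Proof.
move=> single; rewrite (reindex (fun b : bool => [set z : T | b])) //=.
apply: onW_bij; exists (fun S : {set T} => x \in S) => [b | S].
  by rewrite inE.
by apply/setP => z; rewrite (single z) inE.
Qed.

Variables x y : T.

(** The two elements are kept abstract to serve both [bool] (middle corners of a square) and ['I_2]
    (pendant vertices). *)
Definition pair_set (p q : bool) : {set T} := [set z | if z == x then p else q].

Hypotheses (neq_xy : y != x) (cover : forall z, (z == x) || (z == y)).

Lemma big_set_pair (F : {set T} -> {poly int}) :
  \sum_S F S = \sum_(p : bool) \sum_(q : bool) F (pair_set p q).
Proof.
rewrite pair_bigA (reindex (fun b : bool * bool => pair_set b.1 b.2)) //=.
apply: onW_bij; exists (fun S : {set T} => (x \in S, y \in S)) => [[p q] | S].
  by rewrite !inE eqxx (negPf neq_xy).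
apply/setP => z; rewrite inE /=.
by have /orP[/eqP -> | /eqP ->] := cover z; rewrite ?eqxx // (negPf neq_xy).
Qed.

Lemma card_pair_set p q : #|pair_set p q| = (p + q)%N.
Proof.
rewrite -sum1_card big_mkcond (bigD1 x) // (bigD1 y) //= big1 ?addn0.
  by rewrite !inE eqxx (negPf neq_xy); case: p; case: q.
by move=> z /andP[/negPf zx /negPf zy]; have := cover z; rewrite zx zy.
Qed.

Lemma exists_pair (P : pred T) : [exists z, P z] = P x || P y.
Proof.
apply/existsP/orP => [[z] | [Px | Py]]; [|by exists x|by exists y].
by have /orP[/eqP -> | /eqP ->] := cover z; [left | right].
Qed.

Lemma forall_pair (P : pred T) : [forall z, P z] = P x && P y.
Proof.
apply/forallP/andP => [all_P // | [Px Py] z].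
by have /orP[/eqP -> | /eqP ->] := cover z.
Qed.

End SmallSets.

(** * Gluing a square and moving the root to the opposite corner *)

Section Square.
Variables (G : sgraph) (r : G).

(* [inr (inl tt)] is the corner opposite to [r], and [inr (inr b)] are the two
   remaining corners. *)
Definition square_vertex : finType := (G + (unit + bool))%type.

Definition square_adj : rel square_vertex := fun u v =>
  match u, v with
  | inl x, inl y => adj x y
  | inl x, inr (inr _) | inr (inr _), inl x => x == r
  | inr (inl _), inr (inr _) | inr (inr _), inr (inl _) => true
  | _, _ => false
  end.

Lemma square_adj_sym : symmetric square_adj.
Proof. by move=> [x|[u|p]] [y|[v|q]] //=; apply: adj_sym. Qed.

Lemma square_adj_irrefl : irreflexive square_adj.
Proof. by move=> [x|[u|p]] //=; apply: adj_irrefl. Qed.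

Definition square : sgraph := SGraph square_adj_sym square_adj_irrefl.

Definition square_root : square := inr (inl tt).

(* [c], [p], [q] say whether the opposite corner and the two middle corners are
   in the set; [d], [i] give the state of the old root, [g] weights that of the
   new one. *)
Definition square_transfer (g : bool -> bool -> {poly int}) (d i : bool) :=
  \sum_(c : bool) \sum_(p : bool) \sum_(q : bool)
    if [&& [|| d, p | q], [|| p, i | c] & [|| q, i | c]]
    then g [|| c, p | q] c * 'X^(c + (p + q)) else 0.

Let cover_bool (z : bool) : (z == true) || (z == false).
Proof. by case: z. Qed.

Let ext (S : {set G}) (c p q : bool) : {set square} :=
  set_sum S (set_sum [set z : unit | c] (pair_set true p q)).

Let dominated_old S c p q x :
  dominated (ext S c p q) (inl x : square)
    = dominated S x || (x == r) && (p || q).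
Proof.
rewrite /dominated inl_set_sum !exists_sum -orbA; congr (_ || (_ || _)).
  by apply: eq_existsb => y; rewrite inl_set_sum.
rewrite (exists_pair cover_bool) !inr_set_sum !inE /=.
rewrite existsb_false.
by case: (x == r); rewrite ?andbT ?andbF.
Qed.

Let dominated_root S c p q :
  dominated (ext S c p q) square_root = [|| c, p | q].
Proof.
rewrite /dominated !exists_sum (exists_pair cover_bool) !inE /= !andbT.
by rewrite !existsb_false inl_set_sum inE.
Qed.

Let dominated_side S c p q (b : bool) :
  dominated (ext S c p q) (inr (inr b) : square)
    = [|| if b then p else q, r \in S | c].
Proof.
rewrite /dominated !exists_sum (exists_pair cover_bool) !inE /= !andbF !orbF.
congr [|| _, _ | _]; first by case: b.
  apply/existsP/idP => [[y] | rS]; last by exists r; rewrite inE rS /=.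
  by rewrite inE /= => /andP[yS /eqP <-].
apply/existsP/idP => [[y] | cT]; first by rewrite !inE andbT.
by exists tt; rewrite !inE cT.
Qed.

(** The opposite corner is the new root and hence exempt. The old root is no longer exempt but may
    be dominated by a middle corner, and each middle corner sees exactly the two roots. *)
Let dominating_off_ext S c p q :
  dominating_off square_root (ext S c p q)
    = dominating_off r S &&
      [&& [|| dominated S r, p | q], [|| p, r \in S | c] & [|| q, r \in S | c]].
Proof.
rewrite /dominating_off !forall_sum (forall_pair cover_bool) !dominated_side /=.
rewrite (_ : [forall x : unit, _] = true) /=; last by apply/forallP => -[].
rewrite [RHS]andbA -forall_dominated_root; congr (_ && _).
by apply: eq_forallb => x; rewrite dominated_old.
Qed.

Lemma rooted_poly_square g :
  rooted_poly square_root g = rooted_poly r (square_transfer g).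
Proof.
rewrite /rooted_poly big_mkcond big_set_sum [RHS]big_mkcond /=.
apply: eq_bigr => S _; rewrite big_set_sum (@big_set_single _ tt); last by case.
(* Writing the condition on [S] as a boolean multiple lets it pass inside the sums over [c], [p] and
   [q]. *)
rewrite -mulrb /square_transfer !big_distrl -sumrMnl; apply: eq_bigr => c _.
rewrite (@big_set_pair _ true false) //= !big_distrl -sumrMnl.
apply: eq_bigr => p _; rewrite !big_distrl -sumrMnl; apply: eq_bigr => q _.
rewrite -/(ext S c p q) dominating_off_ext dominated_root !card_set_sum.
rewrite (card_pair_set _ cover_bool) // !inE cardsE.
have -> : #|fun _ : unit => c| = c :> nat by case: c; rewrite ?card_unit ?card0.
case: dominating_off => //=; case: ifP => _; rewrite mulr1n ?mul0r //.
by rewrite inl_set_sum inE -mulrA -exprD addnC.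
Qed.

End Square.

(** * Attaching two pendant vertices at the root *)

Section Pendants.
Variables (G : sgraph) (r : G).

(** Here no vertex stays exempt: [d] and [i] give the state of [r], while [p] and [q] say which
    pendants are chosen. Both are forced in when [r] is not in the set. *)
Definition pendants_transfer (d i : bool) : {poly int} :=
  \sum_(p : bool) \sum_(q : bool)
    if [&& [|| d, p | q], p || i & q || i] then 'X^(p + q) else 0.

Let cover_ord2 (z : 'I_2) : (z == ord0) || (z == ord_max).
Proof. by case: z => [[|[|]]]. Qed.

Let ext (S : {set G}) (p q : bool) : {set two_pendants r} :=
  set_sum S (pair_set ord0 p q).

Let dominated_old S p q x :
  dominated (ext S p q) (inl x : two_pendants r)
    = dominated S x || (x == r) && (p || q).
Proof.
rewrite /dominated inl_set_sum exists_sum -orbA; congr (_ || (_ || _)).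
  by apply: eq_existsb => y; rewrite inl_set_sum.
rewrite (exists_pair cover_ord2) !inr_set_sum !inE /=.
by case: (x == r); rewrite ?andbT ?andbF.
Qed.

Let dominated_pendant S p q (k : 'I_2) :
  dominated (ext S p q) (inr k : two_pendants r)
    = (if k == ord0 then p else q) || (r \in S).
Proof.
rewrite /dominated exists_sum (exists_pair cover_ord2) !inE /= !andbF !orbF.
congr (_ || _); apply/existsP/idP => [[y] | rS].
  by rewrite inE /= => /andP[yS /eqP <-].
by exists r; rewrite inE rS /=.
Qed.

Lemma domination_poly_pendants :
  domination_poly (two_pendants r) = rooted_poly r pendants_transfer.
Proof.
rewrite domination_polyE /rooted_poly big_mkcond big_set_sum [RHS]big_mkcond /=.
apply: eq_bigr => S _; rewrite (@big_set_pair _ ord0 ord_max) //.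
rewrite -mulrb /pendants_transfer !big_distrl -sumrMnl; apply: eq_bigr => p _.
rewrite !big_distrl -sumrMnl; apply: eq_bigr => q _.
rewrite -/(ext S p q) dominatingE forall_sum (forall_pair cover_ord2).
rewrite !dominated_pendant card_set_sum (card_pair_set _ cover_ord2) //=.
rewrite (eq_forallb (dominated_old S p q)) forall_dominated_root.
case: dominating_off => //=; case: ifP => _; rewrite mulr1n ?mul0r //.
by rewrite -exprD addnC.
Qed.

End Pendants.

(** * The para-chain as an iterated gluing of squares *)

Definition para_root n : para_chain n := inl ord_max.

Definition square_to_para n (v : square (para_root n)) : para_chain n.+1 :=
  match v with
  | inl (inl i) => inl (widen_ord (leqnSn n.+1) i)
  | inl (inr (inl j)) => inr (inl (widen_ord (leqnSn n) j))
  | inl (inr (inr j)) => inr (inr (widen_ord (leqnSn n) j))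
  | inr (inl _) => inl ord_max
  | inr (inr b) => inr (if b then inl ord_max else inr ord_max)
  end.

Lemma square_to_para_inj n : injective (@square_to_para n).
Proof.
(* The only possible collisions are between a widened old index and the new largest index. *)
have ord_neq m (k : 'I_m) : k = m :> nat -> False.
  by move=> k_eq_m; have := ltn_ord k; rewrite k_eq_m ltnn.
move=> [[i|[j|j]]|[[]|[]]] [[i'|[j'|j']]|[[]|[]]] //= [].
all: try by move/val_inj => ->.
all: try by move/ord_neq.
all: by move/esym/ord_neq.
Qed.

Lemma square_to_para_bij n : bijective (@square_to_para n).
Proof.
apply: inj_card_bij; first exact: square_to_para_inj.
rewrite !card_sum !card_ord card_unit card_bool; lia.
Qed.

Lemma square_to_para_adj n :
  {mono @square_to_para n : u v / adj u v >-> adj u v}.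
Proof.
(* The new square meets the old cut-vertices only in the old root, and the new cut-vertex lies on no
   old square. *)
have old_end (i : 'I_n.+1) :
    (i == n :> nat) || (i == n.+1 :> nat) = (inl i == para_root n).
  by rewrite (ltn_eqF (ltn_ord i)) orbF.
have new_end (j : 'I_n) : (n.+1 == j) || (n.+1 == j.+1) = false.
  by rewrite eqSS !gtn_eqF // ltnS ltnW.
move=> [[i|[j|j]]|[[]|[]]] [[i'|[j'|j']]|[[]|[]]] //=.
all: rewrite /square_end /= ?eqxx ?orbT //.
all: by rewrite ?new_end ?old_end.
Qed.

Lemma rooted_poly_para n g :
  rooted_poly (para_root n.+1) g
    = rooted_poly (para_root n) (square_transfer g).
Proof.
rewrite -rooted_poly_square.
rewrite -(rooted_poly_iso (square_root _) _ (@square_to_para_bij n)) //.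
exact: square_to_para_adj.
Qed.

(** The condition off the root is vacuous for a single vertex, so both of its subsets count, and the
    empty one leaves the root undominated. *)
Lemma rooted_poly_para0 g :
  rooted_poly (para_root 0) g = g true true * 'X + g false false.
Proof.
have single (z : para_chain 0) : z = para_root 0.
  by case: z => [i|[[]|[]] //]; rewrite [i]ord1; congr inl; apply: val_inj.
rewrite /rooted_poly big_mkcond (big_set_single _ single) big_bool /=.
have off S : dominating_off (para_root 0) S.
  by apply/forallP => z; rewrite (single z) eqxx.
rewrite !off /dominated !inE /= !cardsE card0 mulr1.
rewrite (_ : [exists _, _] = false); last by apply/existsP => -[z]; rewrite inE.
by rewrite (eq_card (B := para_chain 0)) // !card_sum !card_ord.
Qed.

(** Taking for [g] the indicator of a new state reads off one row of the transfer matrix. The weight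
    [g false false] appears only once: an undominated new root has both middle corners outside the
    set, so they need the old root in it. *)
Lemma square_transferE g :
  [/\ square_transfer g true true
         = 'X * (1 + 'X) ^+ 2 * g true true + ('X *+ 2 + 'X^2) * g true false
           + g false false,
      square_transfer g true false
         = 'X * (1 + 'X) ^+ 2 * g true true + 'X^2 * g true false
    & square_transfer g false false
         = ('X^3 + 'X^2 *+ 2) * g true true + 'X^2 * g true false].
Proof. by split; rewrite /square_transfer !big_bool /=; ring. Qed.

(** * State recurrences along the chain and the final identity *)

Section ParaStates.
Implicit Type n : nat.

(** [para_in], [para_out] and [para_undom] are the polynomials A, B and U, rooted at the last
    cut-vertex. *)
Definition para_in n := rooted_poly (para_root n) (fun _ i => i%:R).
Definition para_out n := rooted_poly (para_root n) (fun d i => (d && ~~ i)%:R).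
Definition para_undom n := rooted_poly (para_root n) (fun d _ => (~~ d)%:R).

Lemma para_rootedE n g :
  rooted_poly (para_root n) g = g true true * para_in n
    + g true false * para_out n + g false false * para_undom n.
Proof. exact: rooted_polyE. Qed.

Lemma para_inS n : para_in n.+1 =
  'X * (1 + 'X) ^+ 2 * (para_in n + para_out n)
  + ('X^3 + 'X^2 *+ 2) * para_undom n.
Proof.
rewrite [LHS]rooted_poly_para para_rootedE.
by have [-> -> ->] := square_transferE (fun _ i => i%:R) => /=; ring.
Qed.

Lemma para_outS n : para_out n.+1 =
  ('X *+ 2 + 'X^2) * para_in n + 'X^2 * (para_out n + para_undom n).
Proof.
rewrite [LHS]rooted_poly_para para_rootedE.
by have [-> -> ->] := square_transferE (fun d i => (d && ~~ i)%:R) => /=; ring.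
Qed.

Lemma para_undomS n : para_undom n.+1 = para_in n.
Proof.
rewrite [LHS]rooted_poly_para para_rootedE.
by have [-> -> ->] := square_transferE (fun d _ => (~~ d)%:R) => /=; ring.
Qed.

Lemma para_in0 : para_in 0 = 'X.
Proof. by rewrite [LHS]rooted_poly_para0 /=; ring. Qed.

Lemma para_out0 : para_out 0 = 0.
Proof. by rewrite [LHS]rooted_poly_para0 /=; ring. Qed.

Lemma para_undom0 : para_undom 0 = 1.
Proof. by rewrite [LHS]rooted_poly_para0 /=; ring. Qed.

Lemma domination_poly_para n :
  domination_poly (para_chain n) = para_in n + para_out n.
Proof.
by rewrite (domination_poly_rooted (para_root n)) para_rootedE /=; ring.
Qed.

Lemma domination_poly_para' n :
  domination_poly (para_chain' n)
    = (1 + 'X) ^+ 2 * para_in n + 'X^2 * (para_out n + para_undom n).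
Proof.
rewrite domination_poly_pendants para_rootedE /pendants_transfer !big_bool /=.
by ring.
Qed.

End ParaStates.

Theorem theorem7 :
  (forall n : nat, (3 <= n)%N ->
     domination_poly (para_chain n) =
       ('X^3 + 2 *: 'X^2 + 'X) * domination_poly (para_chain (n - 1))
       + ('X^3 + 2 *: 'X^2) * domination_poly (para_chain (n - 2))
       + ('X^3 + 3 *: 'X^2) * domination_poly (para_chain' (n - 2))
       + (2 *: 'X^4 + 4 *: 'X^3) * domination_poly (para_chain' (n - 3)))
  /\ domination_poly (para_chain 1) = 'X^4 + 4 *: 'X^3 + 6 *: 'X^2
  /\ domination_poly (para_chain 2) =
       'X^7 + 7 *: 'X^6 + 21 *: 'X^5 + 29 *: 'X^4 + 15 *: 'X^3.
Proof.
pose paraS := (para_inS, para_outS, para_undomS).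
pose para0 := (para_in0, para_out0, para_undom0).
split=> [[|[|[|n]]] // _ | ]; last first.
  by rewrite !domination_poly_para !paraS !para0 !scaler_nat; split; ring.
(* The length is now [n.+3], and both sides unfold to combinations of the three state polynomials at
   [n]. The identity holds with these as free variables, so no induction is required. *)
rewrite !subSS !subn0 !domination_poly_para !domination_poly_para' !paraS.
by rewrite !scaler_nat; ring.
Qed.
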